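(* Consider a protocol between Alice and Bob for Oblivious Transfer of the form described in the context (a preparation phase giving $X_1^n$ to Alice and $(X_{\mathcal I},\mathcal I)$ to honest Bob, plus leaked sets $(I_G,I_B)$ with parameter $\mu\in(0,1]$ to dishonest Alice, followed by a purely classical post-processing with messages $M$). Assume: 1. the statement $\mathfrak P_F$ is true: there exists a function $F(\cdot,\cdot)$ such that $F(X_1^n,M)=:(I_0,I_1)$, where $I_0,I_1\subseteq[n]$ are such that $I_C$ stabilizes $f_C$ but not $f_{1-C}$ (w.r.t. $(X_1^n,M)$), and $I_{1-C}$ stabilizes $f_{1-C}$ but not $f_C$ (w.r.t. $(X_1^n,M)$), where $C$ is honest Bob's output bit; 2. $\Pr(\Omega_\kappa)$ is non-negligible in $n$, where $\kappa:=\min\big(|(I_0\setminus I_1)\cap(I_G\cup I_B)|,\ |(I_1\setminus I_0)\cap(I_G\cup I_B)|\big)$ and $\Omega_\kappa$ is the event ''$\kappa\ge1$''. Let $\alpha\in(0,1]$ be such that $|(I_{1-C}\setminus I_C)\cap(I_G\cup I_B)\cap\mathcal I|=(1-\alpha)\,|(I_{1-C}\setminus I_C)\cap(I_G\cup I_B)|$, i.e. $\alpha$ is the fraction of indices in $(I_{1-C}\setminus I_C)\cap(I_G\cup I_B)$ that are not in $\mathcal I$. Let $P_{\rm guess}$ be the maximum probability that Alice correctly guesses Bob's bit $C$. If the protocol is correct and secure against dishonest Bob, then the strategy for dishonest Alice described in the context allows her to guess $C$ with probability $P_{\rm guess}=\frac12+{\rm adv}$, where $${\rm adv}\ \ge\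 \Pr(\Omega_\kappa)\times\alpha\,\mu .$$ Moreover $\alpha\ge1/n$, which is not negligible in $n$.
   Context: A function of $n$ is negligible if for every $a>0$ it is smaller than $1/n^a$ for $n$ large enough. Setting. The preparation (quantum) phase is abstracted by its outputs: - Honest Alice gets a random bit string $X_1^n\in\{0,1\}^n$ with distribution $P_{X_1^n}$. - Honest Bob gets a random subset $\mathcal I\subseteq[n]$ with distribution $P_{\mathcal I}$ and the substring $X_{\mathcal I}$ of bits of $X_1^n$ indexed by $\mathcal I$. - Dishonest Alice gets $X_1^n$ and additionally sets $I_G,I_B\subseteq[n]$ with $I_G\cap I_B=\emptyset$ and $|I_G\cup I_B|=\gamma n$ for some $\gamma\in(0,1)$. For $i\in I_G\cup I_B$: if $i\in\mathcal I$ then $i\in I_G$ with probability $\frac12(1+\mu)$ and $i\in I_B$ with probability $\frac12(1-\mu)$; if $i\notin\mathcal I$ then $i\in I_G$ with probability $\frac12(1-\mu)$ and $i\in I_B$ with probability $\frac12(1+\mu)$. This can be seen as first giving $I_G\cup I_B$ to Alice and then giving her $I_G$ and $I_B$ through this random process; the probability for an element of $I_G\cup I_B$ to be in $I_G$ is independent of the event $\Omega_\kappa$, which depends on $I_G\cup I_B$ but not on how it is partitioned. - Dishonest Bob holds a classical register $K$ and a quantum register $Q$ (of bounded size) such that his min-entropy rate $H_{\min}(X_1^n|KQ)/n$ is smaller than that of honest Bob. Post-processing: Alice and Bob exchange classical messages $M=(M_{AB},M_{BA})$ (from Alice to Bob and from Bob to Alice respectively). Honest Alice outputs $(S_0,S_1)=(f_0(X_1^n,M),f_1(X_1^n,M))\in\{0,1\}^l\times\{0,1\}^l$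 and honest Bob outputs $(C,S_C)=(g(X_{\mathcal I},\mathcal I,M),\tilde g(X_{\mathcal I},\mathcal I,M))$, with $f_0,f_1,g,\tilde g$ fixed functions determined by the protocol. Dishonest Alice is semi-honest: she runs the post-processing honestly but records everything she sends and receives. Stabilization: $J\subseteq[n]$ stabilizes $f_a$ ($a\in\{0,1\}$) w.r.t. values $(x_1^n,m)$ if $x_{J^c}\mapsto f_a((x_{J^c},x_J),m)$ is constant over all $x_{J^c}$ with $\Pr\big((X_1^n,M)=((x_{J^c},x_J),m)\big)\ne0$, where $(x_{J^c},x_J)$ is the string with bits $x_J$ at positions $J$ and $x_{J^c}$ at positions $J^c$. It stabilizes $f_a$ w.r.t. $(X_1^n,M)$ when this holds for the realized value of $(X_1^n,M)$. Correctness and security against dishonest Bob are those of randomized 1-out-2 oblivious transfer: for honest parties $S_0,S_1,C$ are (close to) uniform and independent and Bob obtains the string $S_C$; a dishonest Bob remains ignorant about at least one of $S_0,S_1$. In this setting, correctness and security against dishonest Bob are taken to entail that the sets satisfy $I_C\subseteq\mathcal I$ and $I_{1-C}\not\subseteq\mathcal I$. Dishonest Alice's strategy (inputs $x_1^n,m,I_G,I_B$; output a guess $b$ for $C$): compute $(I_0,I_1)=F(x_1^n,m)$. If $(I_0\setminus I_1)\cap(I_G\cup I_B)=\emptyset$ or $(I_1\setminus I_0)\cap(I_G\cup I_B)=\emptyset$, output a uniformly random $b\in\{0,1\}$. Otherwise sample a uniformly random bit $r$, choose $i_r\in(I_r\setminus I_{1-r})\cap(I_G\cup I_B)$ uniformly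 at random, and output $b=r$ if $i_r\in I_G$ and $b=1-r$ if $i_r\in I_B$.
   Formalization: The bound is proved as adv ≥ Pr(Ω_κ)·αμ/2, since the printed one without 1/2 is false (α=μ=Pr(Ω_κ)=1 would give P_guess ≥ 3/2); α ≥ 1/n is claimed only for n where (I_{1-C}∖I_C)∩(I_G∪I_B) is nonempty with positive probability, as otherwise α is undetermined. *)

(* Defs.v *)
(* MathComp world, with realType and powR from MathComp-Analysis. *)
From HB Require Import structures.
From mathcomp Require Import all_boot all_order all_algebra.
From mathcomp Require Import reals exp.

Set Implicit Arguments.
Unset Strict Implicit.
Unset Printing Implicit Defensive.

Import Order.TTheory GRing.Theory Num.Theory.
Local Open Scope ring_scope.

Definition negligible (R : realType) (f : nat -> R) : Prop :=
  forall a : R, 0 < a ->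
  exists N : nat, forall n : nat, (N <= n)%N -> f n < (n%:R `^ a)^-1.

Record fdist (R : realType) (T : finType) := Fdist {
  pmf :> T -> R;
  pmf_ge0 : forall t, 0 <= pmf t;
  pmf_sum1 : \sum_t pmf t = 1 }.

Definition Pr (R : realType) (T : finType) (d : fdist R T) (E : pred T) : R :=
  \sum_(t | E t) d t.

Section Joint.
Variables (R : realType) (S T : finType) (d : fdist R S) (k : S -> fdist R T).

Definition joint_pmf (st : S * T) : R := d st.1 * k st.1 st.2.

Lemma joint_ge0 st : 0 <= joint_pmf st.
Proof. by rewrite mulr_ge0 ?pmf_ge0. Qed.

Lemma joint_sum1 : \sum_st joint_pmf st = 1.
Proof.
rewrite -(pair_bigA _ (fun s t => d s * k s t)) /= -(pmf_sum1 d).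
by apply: eq_bigr => s _; rewrite -mulr_sumr pmf_sum1 mulr1.
Qed.

(* Law of (s, t) when s is drawn from d and then t from k s. *)
Definition joint : fdist R (S * T)%type := Fdist joint_ge0 joint_sum1.
End Joint.

Definition bits (n : nat) : finType := {ffun 'I_n -> bool}.

Definition substring (n : nat) (x : bits n) (I : {set 'I_n}) : seq bool :=
  [seq x i | i <- enum I].

(* A protocol as seen by honest parties.  [prep] is the joint law of Alice's
   string and Bob's index set.  [post x y I] is the law of the transcript when
   Alice enters the post-processing with x and Bob with (y, I), so that any
   local randomness and any number of rounds is allowed.  Bits are booleans:
   [fA p false] and [fA p true] are f_0 and f_1. *)
Record protocol (R : realType) (n : nat) := Protocol {
  msgAB : finType;
  msgBA : finType;
  outlen : nat;
  prep : fdist R (bits n * {set 'I_n})%type;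
  post : bits n -> seq bool -> {set 'I_n} -> fdist R (msgAB * msgBA)%type;
  fA : bool -> bits n -> msgAB * msgBA -> outlen.-tuple bool;
  gB : seq bool -> {set 'I_n} -> msgAB * msgBA -> bool;
  gtB : seq bool -> {set 'I_n} -> msgAB * msgBA -> outlen.-tuple bool }.

Definition msg (R : realType) (n : nat) (p : protocol R n) : finType :=
  (msgAB p * msgBA p)%type.

(* What a dishonest Alice additionally obtains from the preparation phase:
   [leak_set x I] is the law of the set W = I_G :|: I_B, and [leak_part I W]
   the law of the pair (I_G, I_B).  As [leak_part] sees only I and W, the
   partition is independent of x and of the transcript given (I, W). *)
Record leakage (R : realType) (n : nat) := Leakage {
  leak_set : bits n -> {set 'I_n} -> fdist R {set 'I_n};
  leak_part : {set 'I_n} -> {set 'I_n} ->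
    fdist R ({set 'I_n} * {set 'I_n})%type }.

(* Only the individual probabilities of the events i \in I_G are prescribed;
   their correlations for distinct i are arbitrary. *)
Definition leakage_spec (R : realType) (n : nat) (L : leakage R n)
    (gamma mu : R) : Prop :=
  [/\ forall x I W, 0 < leak_set L x I W -> #|W|%:R = gamma * n%:R,
      forall I W G B, 0 < leak_part L I W (G, B) ->
        G :&: B = set0 /\ G :|: B = W
    & forall (I W : {set 'I_n}) (i : 'I_n), i \in W ->
        Pr (leak_part L I W) (fun GB => i \in GB.1) =
          (if i \in I then (1 + mu) / 2 else (1 - mu) / 2)
        /\
        Pr (leak_part L I W) (fun GB => i \in GB.2) =
          (if i \in I then (1 - mu) / 2 else (1 + mu) / 2)].

Section Protocol.
Variables (R : realType) (n : nat) (p : protocol R n).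

(* Law of (x, I, m) in a run with honest parties. *)
Definition honest_run : fdist R (bits n * {set 'I_n} * msg p)%type :=
  joint (prep p) (fun xI => post p xI.1 (substring xI.1 xI.2) xI.2).

(* Bob's output bit C. *)
Definition outC (x : bits n) (I : {set 'I_n}) (m : msg p) : bool :=
  gB (substring x I) I m.

Definition PrXM (y : bits n) (m : msg p) : R :=
  Pr honest_run (fun o => (o.1.1 == y) && (o.2 == m)).

Definition stabilizes (J : {set 'I_n}) (a : bool) (x : bits n) (m : msg p) :
    Prop :=
  forall y z : bits n,
    {in J, y =1 x} -> PrXM y m != 0 ->
    {in J, z =1 x} -> PrXM z m != 0 ->
    fA a y m = fA a z m.

(* [F x m a] is I_a. *)
Definition set_finder : Type := bits n -> msg p -> bool -> {set 'I_n}.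

Variable F : set_finder.

Definition statement_PF : Prop :=
  forall x I m, 0 < honest_run (x, I, m) ->
    let C := outC x I m in
    [/\ stabilizes (F x m C) C x m, ~ stabilizes (F x m C) (~~ C) x m,
        stabilizes (F x m (~~ C)) (~~ C) x m
      & ~ stabilizes (F x m (~~ C)) C x m].

(* The form in which correctness and security against a dishonest Bob enter:
   I_C \subset I, and I_(1-C) is not a subset of I. *)
Definition correct_secure_sets : Prop :=
  forall x I m, 0 < honest_run (x, I, m) ->
    let C := outC x I m in
    F x m C \subset I /\ ~~ (F x m (~~ C) \subset I).

(* (I_a \ I_(1-a)) /\ (I_G \/ I_B) *)
Definition exclusive (x : bits n) (m : msg p) (G B : {set 'I_n}) (a : bool) :
    {set 'I_n} :=
  (F x m a :\: F x m (~~ a)) :&: (G :|: B).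

Definition kappa (x : bits n) (m : msg p) (G B : {set 'I_n}) : nat :=
  minn #|exclusive x m G B false| #|exclusive x m G B true|.

Definition strategy : Type :=
  bits n -> msg p -> {set 'I_n} -> {set 'I_n} -> fdist R bool.

(* Probability that the attack outputs b: a fair coin when one of the two sets
   is empty, and otherwise the average over a fair coin r and a uniform
   i in [exclusive x m G B r]. *)
Definition attack_pmf (x : bits n) (m : msg p) (G B : {set 'I_n}) (b : bool) :
    R :=
  let D := exclusive x m G B in
  if (D false == set0) || (D true == set0) then 2^-1 else
  \sum_(r : bool) 2^-1 *
    \sum_(i in D r)
      #|D r|%:R^-1 * ((if i \in G then r else ~~ r) == b)%:R.

Lemma attack_ge0 x m G B b : 0 <= attack_pmf x m G B b.
Proof.
rewrite /attack_pmf; case: ifP => _; first by rewrite invr_ge0 ler0n.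
apply: sumr_ge0 => r _; rewrite mulr_ge0 ?invr_ge0 ?ler0n//.
by apply: sumr_ge0 => i _; rewrite mulr_ge0 ?invr_ge0 ?ler0n.
Qed.

Lemma attack_sum1 x m G B : \sum_b attack_pmf x m G B b = 1.
Proof.
have half2 : 2^-1 + 2^-1 = 1 :> R by rewrite [RHS]splitr mul1r.
rewrite /attack_pmf; case: (boolP (_ || _)) => [_|]; first by rewrite big_bool.
rewrite negb_or => /andP[D0 D1]; rewrite exchange_big /=.
rewrite -[RHS]half2 -[RHS](big_bool _ (fun=> 2^-1)); apply: eq_bigr => r _.
rewrite -mulr_sumr exchange_big /=.
under eq_bigr => i _ do rewrite -mulr_sumr big_bool.
rewrite (eq_bigr (fun=> #|exclusive x m G B r|%:R^-1)) => [|i _]; last first.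
  by case: ifP; case: r; rewrite /= ?addr0 ?add0r mulr1.
rewrite sumr_const -[X in _ * X]mulr_natr.
by rewrite mulVf ?mulr1// pnatr_eq0 cards_eq0; case: r.
Qed.

Definition attack : strategy :=
  fun x m G B => Fdist (attack_ge0 x m G B) (attack_sum1 x m G B).

Variable L : leakage R n.

(* A run with honest Bob and semi-honest Alice: ((((x, I), W), (G, B)), m). *)
Definition outcome : finType :=
  (bits n * {set 'I_n} * {set 'I_n} * ({set 'I_n} * {set 'I_n}) * msg p)%type.

Definition oX (o : outcome) : bits n := o.1.1.1.1.
Definition oI (o : outcome) : {set 'I_n} := o.1.1.1.2.
Definition oG (o : outcome) : {set 'I_n} := o.1.2.1.
Definition oB (o : outcome) : {set 'I_n} := o.1.2.2.
Definition oM (o : outcome) : msg p := o.2.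
Definition oC (o : outcome) : bool := outC (oX o) (oI o) (oM o).

Definition run : fdist R outcome :=
  joint
    (joint (joint (prep p) (fun xI => leak_set L xI.1 xI.2))
           (fun xIW => leak_part L xIW.1.2 xIW.2))
    (fun u => post p u.1.1.1 (substring u.1.1.1 u.1.1.2) u.1.1.2).

Definition PrOmega : R :=
  Pr run (fun o => 1 <= kappa (oX o) (oM o) (oG o) (oB o))%N.

(* (I_(1-C) \ I_C) /\ (I_G \/ I_B) *)
Definition otherset (o : outcome) : {set 'I_n} :=
  exclusive (oX o) (oM o) (oG o) (oB o) (~~ oC o).

Definition fraction_outside (alpha : R) : Prop :=
  forall o : outcome, 0 < run o ->
    #|otherset o :&: oI o|%:R = (1 - alpha) * #|otherset o|%:R.

Definition success (A : strategy) : R :=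
  \sum_o run o * A (oX o) (oM o) (oG o) (oB o) (oC o).

Definition Pguess : R :=
  sup (fun v : R => exists A : strategy, v = success A).
End Protocol.

(* Main.v *)
(* Condition on (x, I, W, m) with W = I_G :|: I_B.  The sets
   D_a = (I_a \ I_(1-a)) :&: W are then fixed, and the partition of W is
   independent of m.  If one of them is empty, the guess is a fair coin.
   Otherwise, drawing r = C gives an index of D_C, which lies in I, so the vote is
   right with probability (1 + mu) / 2; drawing r = 1 - C gives an index outside I
   with probability alpha, so the vote is right with probability
   (1 + mu (2 alpha - 1)) / 2.  These average to 1 / 2 + alpha mu / 2, and hence
   adv is exactly Pr(Omega) alpha mu / 2.

   The bound alpha >= 1 / n holds because alpha #|D_(1-C)| is a positive integer
   and #|D_(1-C)| <= n.  It is available only where D_(1-C) is nonempty with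
   positive probability; at every other n, Pr(Omega) = 0, so if alpha were
   negligible then Pr(Omega) would vanish for all large n. *)
Require Import Defs.
From mathcomp Require Import all_boot all_order all_algebra.
From mathcomp Require Import reals exp.
From mathcomp Require Import ring lra.

Set Implicit Arguments.
Unset Strict Implicit.
Unset Printing Implicit Defensive.

Import Order.TTheory GRing.Theory Num.Theory.
Local Open Scope ring_scope.

Section FiniteDistributions.
Variables (R : realType) (T : finType) (d : fdist R T).

Lemma eq_expect (f g : T -> R) :
  (forall t, 0 < d t -> f t = g t) -> \sum_t d t * f t = \sum_t d t * g t.
Proof.
move=> fg; apply: eq_bigr => t _.
by have := pmf_ge0 d t; rewrite le_eqVlt => /predU1P[<-|/fg->//]; rewrite !mul0r.
Qed.

Lemma expect_const (c : R) : \sum_t d t * c = c.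
Proof. by rewrite -mulr_suml pmf_sum1 mul1r. Qed.

Lemma expect_indicator (E : pred T) : \sum_t d t * (E t)%:R = Pr d E.
Proof.
rewrite /Pr [RHS]big_mkcond; apply: eq_bigr => t _.
by case: (E t); rewrite ?mulr1 ?mulr0.
Qed.

Lemma Pr_predC (E : pred T) : Pr d (fun t => ~~ E t) = 1 - Pr d E.
Proof. by rewrite /Pr -(pmf_sum1 d) [X in X - _](bigID E) /= addrAC subrr add0r. Qed.

Lemma pmf_le1 t : d t <= 1.
Proof.
rewrite -(pmf_sum1 d) (bigD1 t)//= lerDl.
by apply: sumr_ge0 => u _; exact: pmf_ge0.
Qed.

Lemma pmf_gt0_exists : exists t, 0 < d t.
Proof.
case: (pickP (fun t => 0 < d t)) => [t dt|d0]; first by exists t.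
have := pmf_sum1 d; rewrite big1 => [/eqP|t _]; first by rewrite eq_sym oner_eq0.
by apply/eqP; have := d0 t; rewrite lt_def pmf_ge0 andbT => /negbFE.
Qed.

Lemma Pr_gt0_exists (E : pred T) : 0 < Pr d E -> exists2 t, 0 < d t & E t.
Proof.
move=> PE; case: (pickP (fun t => (0 < d t) && E t)) => [t /andP[]|d0].
  by exists t.
move: PE; rewrite /Pr big1 ?ltxx// => t Et.
by apply/eqP; have := d0 t; rewrite Et andbT lt_def pmf_ge0 andbT => /negbFE.
Qed.

Lemma le_Pr (E E' : pred T) : subpred E E' -> Pr d E <= Pr d E'.
Proof.
move=> EE'; rewrite -!expect_indicator; apply: ler_sum => t _.
rewrite ler_wpM2l ?pmf_ge0// ler_nat.
by have := EE' t; case: (E t) => // ->.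
Qed.

End FiniteDistributions.

Lemma expect_joint (R : realType) (S T : finType) (d : fdist R S)
    (k : S -> fdist R T) (f : S * T -> R) :
  \sum_st joint d k st * f st = \sum_s d s * \sum_t k s t * f (s, t).
Proof.
under [RHS]eq_bigr => s _ do rewrite mulr_sumr.
by rewrite pair_bigA; apply: eq_bigr => -[s t] _; rewrite mulrA.
Qed.

Section Votes.
Variables (R : realType) (n : nat) (L : leakage R n) (gamma mu : R).
Hypothesis HL : leakage_spec L gamma mu.
Variables (I W : {set 'I_n}).

(** For [r = c] the vote is right exactly when [i] lies in I_G, otherwise exactly when it does not,
    which is the complementary event. *)
Lemma Pr_vote (r c : bool) (i : 'I_n) : i \in W ->
  Pr (leak_part L I W) (fun GB => (if i \in GB.1 then r else ~~ r) == c) =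
  if (i \in I) == (r == c) then (1 + mu) / 2 else (1 - mu) / 2.
Proof.
case: HL => _ _ /(_ I W i) H /H[PG _].
have [->|rc] := eqVneq r c.
  rewrite eqb_id -PG /Pr; apply: eq_bigl => GB.
  by case: ifP; case: c.
rewrite eqbF_neg.
transitivity (Pr (leak_part L I W) (fun GB => ~~ (i \in GB.1))).
  by apply: eq_bigl => GB; case: ifP => _; case: r c rc => [] [].
by rewrite Pr_predC PG; case: ifP => _ /=; field.
Qed.

(** Each summand is affine in the indicator of [I], whose mean over [D] is [beta]. *)
Lemma mean_vote (D : {set 'I_n}) (b : bool) (beta : R) :
  D != set0 -> #|D :&: I|%:R = beta * #|D|%:R ->
  \sum_(i in D) #|D|%:R^-1 *
      (if (i \in I) == b then (1 + mu) / 2 else (1 - mu) / 2) =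
  if b then (1 - mu) / 2 + mu * beta else (1 + mu) / 2 - mu * beta.
Proof.
move=> D0 DI; have cD : #|D|%:R != 0 :> R by rewrite pnatr_eq0 cards_eq0.
have cI : \sum_(i in D) (i \in I)%:R = beta * #|D|%:R :> R.
  rewrite -DI -sum1_card natr_sum big_mkcond [RHS]big_mkcond.
  by apply: eq_bigr => i _; rewrite inE; case: (i \in D) (i \in I) => [] [].
transitivity (\sum_(i in D) (#|D|%:R^-1 *
    ((if b then (1 - mu) / 2 else (1 + mu) / 2) +
     (if b then mu else - mu) * (i \in I)%:R))).
  by apply: eq_bigr => i _; case: b (i \in I) => [] [] /=; congr (_ * _); field.
rewrite -mulr_sumr big_split /= -mulr_sumr cI sumr_const -[X in X + _]mulr_natr.
by case: b; field.
Qed.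

(** As [D] is fixed before the partition is drawn, the two sums can be exchanged; correlations
    between indices then drop out. *)
Lemma expect_vote (D : {set 'I_n}) (r c : bool) (beta : R) :
  D \subset W -> D != set0 -> #|D :&: I|%:R = beta * #|D|%:R ->
  \sum_GB leak_part L I W GB * (\sum_(i in D)
      #|D|%:R^-1 * ((if i \in GB.1 then r else ~~ r) == c)%:R) =
  if r == c then (1 - mu) / 2 + mu * beta else (1 + mu) / 2 - mu * beta.
Proof.
move=> DW D0 DI; rewrite -(mean_vote (r == c) D0 DI).
under eq_bigr => GB _ do rewrite mulr_sumr.
rewrite exchange_big; apply: eq_bigr => i iD.
rewrite -(Pr_vote r c (subsetP DW i iD)) -expect_indicator mulr_sumr.
by apply: eq_bigr => GB _; rewrite mulrCA.
Qed.

End Votes.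

Lemma kappa_gt0 (R : realType) (n : nat) (p : protocol R n) (F : set_finder p)
    (x : bits n) (m : msg p) (G B : {set 'I_n}) (c : bool) :
  (1 <= kappa F x m G B)%N =
  (exclusive F x m G B c != set0) && (exclusive F x m G B (~~ c) != set0).
Proof. by rewrite /kappa leq_min !card_gt0; case: c; rewrite // andbC. Qed.

Section Attack.
Variables (R : realType) (n : nat) (p : protocol R n) (L : leakage R n).
Variables (F : set_finder p) (gamma mu alpha : R).
Hypothesis HL : leakage_spec L gamma mu.
Hypothesis Halpha : fraction_outside F L alpha.
Hypothesis Hsecure : correct_secure_sets F.

(* Since [exclusive] sees (G, B) only through G :|: B = W, conditioning on
   (x, I, W, m) fixes the two sets and leaves only the marginals of G random. *)
Lemma expect_attack_cond (x : bits n) (I W : {set 'I_n}) (m : msg p) :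
  0 < prep p (x, I) -> 0 < leak_set L x I W ->
  0 < post p x (substring x I) I m ->
  \sum_GB leak_part L I W GB * attack_pmf F x m GB.1 GB.2 (outC x I m) =
  \sum_GB leak_part L I W GB *
    (2^-1 + (1 <= kappa F x m GB.1 GB.2)%N%:R * (alpha * mu / 2)).
Proof.
move=> px lW pm; set c := outC x I m.
have GBW GB : 0 < leak_part L I W GB -> GB.1 :|: GB.2 = W.
  by case: HL => _ H _; case: GB => G B /H[].
pose D a := (F x m a :\: F x m (~~ a)) :&: W.
have exD GB a : 0 < leak_part L I W GB -> exclusive F x m GB.1 GB.2 a = D a.
  by move=> /GBW; rewrite /exclusive => ->.
have DW a : D a \subset W by exact: subsetIr.
have [Dn0|/negbTE De] := boolP ((D c != set0) && (D (~~ c) != set0)); last first.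
  (* Degenerate case: [kappa] vanishes and the guess is a fair coin, so both sides are 1/2. *)
  apply: eq_expect => GB q; rewrite (kappa_gt0 _ _ _ _ _ c) !exD// De mul0r addr0.
  rewrite /attack_pmf !exD// ifT//.
  by move/negbT: De; rewrite negb_and !negbK; case: (c) => //; rewrite orbC.
case/andP: (Dn0) => Dc0 DC0.
have DcI : #|D c :&: I|%:R = 1 * #|D c|%:R :> R.
  have /Hsecure[sub _] : 0 < honest_run p (x, I, m) by rewrite mulr_gt0.
  rewrite mul1r (setIidPl _)//; apply: subset_trans sub.
  by rewrite (subset_trans (subsetIl _ _)) ?subsetDl.
have DCI : #|D (~~ c) :&: I|%:R = (1 - alpha) * #|D (~~ c)|%:R :> R.
  (* The hypothesis on [alpha] speaks of full outcomes of positive mass, so any partition of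
     positive mass is picked to complete one. *)
  have [GB q] := pmf_gt0_exists (leak_part L I W).
  rewrite -!(exD GB)//; apply: (Halpha (o := (x, I, W, GB, m))).
  by rewrite !mulr_gt0.
transitivity (\sum_r 2^-1 * \sum_GB leak_part L I W GB *
   \sum_(i in D r) #|D r|%:R^-1 * ((if i \in GB.1 then r else ~~ r) == c)%:R).
  under [RHS]eq_bigr => r _ do rewrite mulr_sumr.
  rewrite exchange_big /=.
  under [RHS]eq_bigr => GB _ do
    under eq_bigr => r _ do rewrite mulrCA.
  under [RHS]eq_bigr => GB _ do rewrite -mulr_sumr.
  apply: eq_expect => GB q; rewrite /attack_pmf !exD// ifF.
    by apply: eq_bigr => r _; rewrite exD.
  apply/negbTE; rewrite negb_or.
  by move: Dn0; case: (c) => //; rewrite andbC.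
rewrite [RHS](eq_expect (g := fun=> 2^-1 + alpha * mu / 2)); last first.
  by move=> GB q; rewrite (kappa_gt0 _ _ _ _ _ c) !exD// Dn0 mul1r.
rewrite expect_const (bigD1 c)//= (bigD1 (~~ c))/=; last by case: (c).
rewrite [X in _ + (_ + X)]big1 ?addr0; last by move=> r; case: r (c) => [] [].
(* The two draws use [beta = 1] and [beta = 1 - alpha] respectively. *)
rewrite (expect_vote HL c c (DW c) Dc0 DcI) eqxx.
rewrite (expect_vote HL (~~ c) c (DW _) DC0 DCI).
by rewrite (_ : (~~ c == c) = false); [field | case: (c)].
Qed.

(** The transcript law does not see the partition, so the partition can be averaged innermost, with
    [x], [I], [W] and [m] fixed. *)
Lemma expect_run (f : outcome p -> R) :
  \sum_o run p L o * f o =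
  \sum_xI prep p xI * \sum_W leak_set L xI.1 xI.2 W *
    \sum_m post p xI.1 (substring xI.1 xI.2) xI.2 m *
      \sum_GB leak_part L xI.2 W GB * f (xI, W, GB, m).
Proof.
rewrite !expect_joint; apply: eq_bigr => xI _; congr (_ * _).
apply: eq_bigr => W _; congr (_ * _).
under eq_bigr => GB _ do rewrite mulr_sumr.
rewrite exchange_big; apply: eq_bigr => m _; rewrite mulr_sumr.
by apply: eq_bigr => GB _; rewrite mulrCA.
Qed.

Lemma success_attack :
  success L (attack F) = 2^-1 + PrOmega F L * (alpha * mu) / 2.
Proof.
transitivity (\sum_o run p L o * (2^-1 +
    (1 <= kappa F (oX o) (oM o) (oG o) (oB o))%N%:R * (alpha * mu / 2))).
  rewrite /success !expect_run; apply: eq_expect => -[x I] px.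
  apply: eq_expect => W lW; apply: eq_expect => m pm.
  exact: expect_attack_cond.
under eq_bigr => o _ do rewrite mulrDr mulrA.
by rewrite big_split expect_const -mulr_suml expect_indicator mulrA.
Qed.

Lemma fraction_outside_ge :
  0 < alpha -> 0 < Pr (run p L) (fun o => otherset F o != set0) ->
  n%:R^-1 <= alpha.
Proof.
move=> a0 /Pr_gt0_exists[o /Halpha]; set D := otherset F o => DI D0.
have kD : (0 < #|D|)%N by rewrite card_gt0.
have kn : (#|D| <= n)%N by rewrite -[X in (_ <= X)%N]card_ord max_card.
have eq_out : alpha * #|D|%:R = #|D :\: oI o|%:R.
  have := congr1 (fun k => k%:R : R) (cardsID (oI o) D).
  by rewrite natrD DI; lra.
have out_ge1 : 1 <= alpha * #|D|%:R.
  by rewrite eq_out ler1n -(ltr0n R) -eq_out mulr_gt0// ltr0n.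
rewrite -div1r ler_pdivrMr ?ltr0n ?(leq_trans kD)//.
by rewrite (le_trans out_ge1)// ler_pM2l// ler_nat.
Qed.

End Attack.

Lemma success_le_Pguess (R : realType) (n : nat) (p : protocol R n)
    (L : leakage R n) (A : strategy p) : success L A <= Pguess p L.
Proof.
apply: ub_le_sup; last by exists A.
(* The bound 1 on success probabilities makes [sup] a genuine supremum. *)
exists 1 => _ [A' ->]; rewrite -(pmf_sum1 (run p L)).
by apply: ler_sum => o _; rewrite ler_piMr ?pmf_ge0 ?pmf_le1.
Qed.

Theorem theorem8 (R : realType) (n0 : nat)
    (p : forall n, protocol R n) (L : forall n, leakage R n)
    (F : forall n, set_finder (p n))
    (gamma : nat -> R) (mu : R) (alpha : nat -> R)
    (hgamma : forall n, (n0 <= n)%N -> 0 < gamma n < 1)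
    (hmu : 0 < mu <= 1)
    (hL : forall n, (n0 <= n)%N -> leakage_spec (L n) (gamma n) mu)
    (hPF : forall n, (n0 <= n)%N -> statement_PF (F n))
    (hOmega : ~ negligible (fun n => PrOmega (F n) (L n)))
    (halpha01 : forall n, (n0 <= n)%N -> 0 < alpha n <= 1)
    (halpha : forall n, (n0 <= n)%N -> fraction_outside (F n) (L n) (alpha n))
    (hsecure : forall n, (n0 <= n)%N -> correct_secure_sets (F n)) :
  [/\ forall n, (n0 <= n)%N ->
        exists adv : R,
          [/\ success (L n) (attack (F n)) = 2^-1 + adv,
              adv >= PrOmega (F n) (L n) * (alpha n * mu) / 2
            & Pguess (p n) (L n) >= 2^-1 + adv],
      forall n, (n0 <= n)%N ->
        0 < Pr (run (p n) (L n)) (fun o => otherset (F n) o != set0) ->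
        alpha n >= n%:R^-1,
      ~ negligible (fun n => n%:R^-1 : R)
    & ~ negligible alpha].
Proof.
have alpha_ge n : (n0 <= n)%N ->
    0 < Pr (run (p n) (L n)) (fun o => otherset (F n) o != set0) ->
    alpha n >= n%:R^-1.
  move=> hn; apply: fraction_outside_ge (halpha n hn) _.
  by case/andP: (halpha01 n hn).
split=> // [n hn||].
- have succ := success_attack (hL n hn) (halpha n hn) (hsecure n hn).
  by eexists; split; [exact: succ | | rewrite -succ; exact: success_le_Pguess].
(* Exponent 1 at [n = N] would give a strict inequality between equal numbers, even for [N = 0],
   where both are 0. *)
- move=> /(_ 1 ltr01)[N /(_ N (leqnn N))].
  by rewrite powRr1 ?ler0n// ltxx.
- move=> /(_ 1 ltr01)[N small]; apply: hOmega => a _.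
  exists (maxn N n0).+1 => n; rewrite gtn_max => /andP[Nn n0n].
  have n_gt0 : (0 < n)%N := leq_ltn_trans (leq0n _) Nn.
  apply: (@le_lt_trans _ _ 0); last by rewrite invr_gt0 powR_gt0 ?ltr0n.
  rewrite leNgt; apply/negP => Omega_gt0.
  have := small n (ltnW Nn); rewrite powRr1 ?ler0n// ltNge alpha_ge ?(ltnW n0n)//.
  (* On Omega both exclusive sets are nonempty, in particular the one for 1 - C. *)
  apply: lt_le_trans Omega_gt0 _; apply: le_Pr => o.
  by rewrite (kappa_gt0 _ _ _ _ _ (oC o)) => /andP[].
Qed.
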